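(* Let $d,n,d_1,\dots,d_n$ be positive integers, let $P:\mathbb{R}^d\to\mathbb{C}$ be a polynomial, and let $\ell_j:\mathbb{R}^d\to\mathbb{R}^{d_j}$, $1\le j\le n$, be a finite collection of surjective linear transformations. If $\{\ell_j\}$ is rationally commensurate, and if $P$ is nondegenerate relative to $\{\ell_j\}$, then $P$ is nondegenerate with a finite witness relative to $\{\ell_j\}$.
   Context: Nondegenerate: $P$ is nondegenerate relative to $\{\ell_j\}$ if $P$ cannot be expressed in the form $P=\sum_{j=1}^n p_j\circ\ell_j$ for any (complex-valued) Lebesgue measurable functions $p_j$ on $\mathbb{R}^{d_j}$. Nondegenerate with a finite witness: $P$ is nondegenerate with a finite witness relative to $\{\ell_j\}$ if there exists a finite set $S\subset\mathbb{R}^d$ such that the restriction $P|_S$ does not belong to the (complex) linear span of the set of all functions $(f_j\circ\ell_j)|_S$, where $j$ ranges over all indices $1\le j\le n$ and $f_j$ over all functions $\mathbb{R}^{d_j}\to\mathbb{C}$. Equivalently, there exist a finite set $S\subset\mathbb{R}^d$ and scalars $c_s$ ($s\in S$) such that $\sum_{s\in S}c_sP(s)\neq 0$ but $\sum_{s\in S}c_sf_j(\ell_j(s))=0$ for all indices $j$ and all functions $f_j$. Rationally commensurate: the collection $\{\ell_j\}$ is rationally commensurate if there exist invertible $\mathbb{R}$-linear transformations $A:\mathbb{R}^d\to\mathbb{R}^d$ and $A_j:\mathbb{R}^{d_j}\to\mathbb{R}^{d_j}$ such that, with respect to the standard bases of $\mathbb{R}^d$ and $\mathbb{R}^{d_j}$,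 the linear transformations $A_j^{-1}\circ\ell_j\circ A$ are all represented by matrices with integer entries. *)

(* Defs.v *)
From HB Require Import structures.
From mathcomp Require Import all_boot all_order all_algebra.
From mathcomp Require Import all_classical all_reals all_analysis.
From mathcomp Require Import measurable_realfun complex.
(* [mpoly] is not imported: its notations clash with those of analysis. *)
From mathcomp Require mpoly.

Set Implicit Arguments.
Unset Strict Implicit.
Unset Printing Implicit Defensive.

Import Order.TTheory GRing.Theory Num.Theory.
Import numFieldNormedType.Exports.

Local Open Scope classical_set_scope.
Local Open Scope ring_scope.
Local Open Scope complex_scope.

(* R^m is ['cV[R]_m] and the complex numbers are [R[i]]. *)

Section Lebesgue.
Variables (R : realType) (m : nat).

Definition box (a b : 'cV[R]_m) : set 'cV[R]_m :=
  [set x | forall i, a i 0 <= x i 0 <= b i 0].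

Definition box_volume (a b : 'cV[R]_m) : R := \prod_(i < m) (b i 0 - a i 0).

Definition lebesgue_outer (A : set 'cV[R]_m) : \bar R :=
  ereal_inf [set v | exists a b : nat -> 'cV[R]_m,
    [/\ forall k i, a k i 0 <= b k i 0,
        A `<=` \bigcup_k box (a k) (b k) &
        v = (\sum_(0 <= k <oo) (box_volume (a k) (b k))%:E)%E]].

Definition borelType := g_sigma_algebraType (@open 'cV[R]_m).

(* The completion of the Borel sigma-algebra: sets [A `|` N] with A Borel and N
   contained in a Borel set of outer measure 0. It is already a sigma-algebra,
   so that generating one from it in [lebesgueType] adds no set. *)
Definition lebesgue_sets : set (set 'cV[R]_m) :=
  completed_algebra_gen (lebesgue_outer : set borelType -> \bar R).

Definition lebesgueType := g_sigma_algebraType lebesgue_sets.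

Definition lebesgue_measurable_fun (f : 'cV[R]_m -> R[i]) : Prop :=
  measurable_fun [set: lebesgueType]
    ((fun x => complex.Re (f x)) : lebesgueType -> measurableTypeR R) /\
  measurable_fun [set: lebesgueType]
    ((fun x => complex.Im (f x)) : lebesgueType -> measurableTypeR R).

End Lebesgue.

Definition poly_fun (R : realType) (d : nat) (P : mpoly.mpoly d R[i])
  : 'cV[R]_d -> R[i] := fun x => mpoly.meval (fun i => (x i 0)%:C) P.

Section Nondegeneracy.
Variables (R : realType) (d n : nat) (dd : 'I_n -> nat).
Variable ell : forall j : 'I_n, {linear 'cV[R]_d -> 'cV[R]_(dd j)}.

Definition nondegenerate_rel (P : 'cV[R]_d -> R[i]) : Prop :=
  ~ exists p : forall j : 'I_n, 'cV[R]_(dd j) -> R[i],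
      (forall j, lebesgue_measurable_fun (p j)) /\
      (forall x, P x = \sum_(j < n) p j (ell j x)).

(* The restriction of g to S is a finite linear combination of restrictions to S
   of members of F. *)
Definition in_span_on (S : set 'cV[R]_d) (F : set ('cV[R]_d -> R[i]))
    (g : 'cV[R]_d -> R[i]) : Prop :=
  exists (N : nat) (c : 'I_N -> R[i]) (h : 'I_N -> 'cV[R]_d -> R[i]),
    (forall k, F (h k)) /\ (forall s, S s -> g s = \sum_(k < N) c k * h k s).

Definition nondegenerate_finite_witness (P : 'cV[R]_d -> R[i]) : Prop :=
  exists S : set 'cV[R]_d, finite_set S /\
    ~ in_span_on S
        [set g | exists (j : 'I_n) (f : 'cV[R]_(dd j) -> R[i]), g = f \o ell j]
        P.

Definition rationally_commensurate : Prop :=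
  exists (A : 'M[R]_d) (B : forall j : 'I_n, 'M[R]_(dd j)),
    [/\ A \in unitmx, forall j, B j \in unitmx &
      forall j, exists M : 'M[int]_(dd j, d),
        forall x : 'cV[R]_d,
          invmx (B j) *m ell j (A *m x) = map_mx intr M *m x].

End Nondegeneracy.

(* Main.v *)
Require Import Defs.
From mathcomp Require Import all_boot all_order all_algebra.
From mathcomp Require Import all_classical all_reals all_analysis.
From mathcomp Require Import measurable_realfun complex.
From mathcomp Require mpoly.
From mathcomp Require Import qpoly.
From mathcomp Require Import ring lra zify.

(** The contrapositive is proved: if P restricted to every finite set is a sum of
    functions f_j o ell_j, then P itself is such a sum with continuous summands.

    Change coordinates by A and B_j so that ell_j becomes an integer matrix M_j,
    and look at the lattice Z^d only. On each finite part of Z^d one has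
    P = sum_j F_j with F_j(z) depending only on M_j z; by compactness for
    countable linear systems ([countable_system_solvable]) this holds on all of
    Z^d at once, with F_j still arbitrary functions. The only regularity of F_j
    is that it has the lattice of integer vectors of ker M_j as periods.

    The F_j are first made continuous. Interpolating a lattice function by
    polynomials of high degree on translated boxes and blending the interpolants
    with tent functions gives an extension operator [extend] from Z^d to R^d
    which commutes with integer translations, so that it keeps periods, and
    which reproduces the polynomial P exactly. Thus P = sum_j g_j on R^d with
    g_j continuous and periodic under the integer vectors of ker M_j.

    Periods are then turned into invariance along whole lines. The averaging
    operator A_w g(x) = int_0^1 g(x + t w) dt keeps all periods of g, and if w
    is a period of g then A_w g does not change along R w. It does change P, but
    P - A_w P has lower degree and is again a sum of functions with the same
    periods, namely g_j - A_w g_j; induction on the degree disposes of it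
    ([straighten_direction]). Doing this for the members w of integer spanning
    families of all ker M_j ([int_kernel_span]) makes the j-th summand invariant
    under the real kernel of M_j. It then factors through ell_j, via a
    continuous function, which is Lebesgue measurable.

    Degree is measured by iterated differences ([frechet_poly]) rather than
    through coefficients, because averaging commutes with differences. *)

Set Implicit Arguments.
Unset Strict Implicit.
Unset Printing Implicit Defensive.

Import Order.TTheory GRing.Theory Num.Theory.
Import numFieldNormedType.Exports.

Local Open Scope classical_set_scope.
Local Open Scope ring_scope.

(** * Continuity of composite functions *)

Section Continuity.
Variables (R : realType) (T : topologicalType).

Lemma continuous_sumf (I : Type) (r : seq I) (f : I -> T -> R) :
  (forall i, continuous (f i)) -> continuous (fun x => \sum_(i <- r) f i x).
Proof.
move=> cf; elim: r => [|i r IH] x.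
  by under eq_fun do rewrite big_nil; exact: cvg_cst.
by under eq_fun do rewrite big_cons; apply: cvgD; [exact: cf|exact: IH].
Qed.

Lemma continuous_prodf (I : Type) (r : seq I) (f : I -> T -> R) :
  (forall i, continuous (f i)) -> continuous (fun x => \prod_(i <- r) f i x).
Proof.
move=> cf; elim: r => [|i r IH] x.
  by under eq_fun do rewrite big_nil; exact: cvg_cst.
by under eq_fun do rewrite big_cons; apply: cvgM; [exact: cf|exact: IH].
Qed.

Lemma continuous_subc (c : R) (f : T -> R) :
  continuous f -> continuous (fun x => f x - c).
Proof. by move=> cf x; apply: cvgB; [exact: cf|exact: cvg_cst]. Qed.

Lemma continuous_mulf (f g : T -> R) :
  continuous f -> continuous g -> continuous (fun x => f x * g x).
Proof. by move=> cf cg x; apply: cvgM; [exact: cf|exact: cg]. Qed.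

Lemma continuous_compf (f : T -> R) (g : R -> R) :
  continuous f -> continuous g -> continuous (fun x => g (f x)).
Proof. by move=> cf cg x; apply: continuous_comp; [exact: cf|exact: cg]. Qed.

Lemma continuous_near_eq (f g : T -> R) (x : T) :
  (\forall y \near x, g y = f y) -> {for x, continuous g} -> {for x, continuous f}.
Proof.
move=> gf cg; have e : g x = f x := nbhs_singleton gf.
by apply: cvg_trans (near_eq_cvg gf) _; rewrite -e; exact: cg.
Qed.

(** The neighbourhoods of a matrix are defined entrywise. *)
Lemma continuous_colP k (f : T -> 'cV[R]_k) :
  (forall i, continuous (fun t => f t i 0)) -> continuous f.
Proof.
move=> cf t A /nbhs_ballP[e e0 eA].
have : \forall s \near t, forall i, `|f t i 0 - f s i 0| < e.
  by apply: filter_forall => i; have /cvgrPdist_lt := cf i t; apply.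
apply: filterS => s h; apply: eA; split => // i j; rewrite ord1; exact: h.
Qed.

End Continuity.

(** * Integrals over the unit interval *)

Section UnitInterval.
Variable R : realType.
Local Notation mu := (@lebesgue_measure R).
Implicit Types h : R -> R.

Lemma continuous_integrable_itv h (a b : R) : continuous h ->
  mu.-integrable `[a, b] (EFin \o h).
Proof.
move=> ch; apply: continuous_compact_integrable; first exact: segment_compact.
exact: continuous_subspaceT.
Qed.

Lemma Rintegral_shift h (a b s : R) : a <= b -> continuous h ->
  \int[mu]_(t in `[a + s, b + s]) h t = \int[mu]_(t in `[a, b]) h (t + s).
Proof.
move=> ab ch; rewrite /Rintegral.
have dF : derive1 (fun t : R => t + s) = cst 1.
  by apply/funext => t; rewrite derive1E deriveD// derive_id derive_cst addr0.
have := @integration_by_substitution_increasing R (fun t => t + s) h a b ab.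
rewrite dF => ->.
- by congr fine; apply: eq_integral => t _; rewrite fctE mulr1.
- by move=> x y _ _ xy; rewrite ltrD2r.
- by move=> x _; exact: cvg_cst.
- exact: is_cvg_cst.
- exact: is_cvg_cst.
- have cF : continuous (fun t : R => t + s).
    by move=> t; apply: cvgD; [exact: cvg_id|exact: cvg_cst].
  split => [x _|/=|/=].
  + by apply: derivableD.
  + by apply: cvg_at_right_filter; exact: cF.
  + by apply: cvg_at_left_filter; exact: cF.
- exact: continuous_subspaceT.
Qed.

Lemma Rintegral_split h (a b c : R) : a <= b -> b <= c -> continuous h ->
  \int[mu]_(t in `[a, c]) h t =
  \int[mu]_(t in `[a, b]) h t + \int[mu]_(t in `[b, c]) h t.
Proof.
move=> ab bc ch.
have ih : mu.-integrable `[a, c] (EFin \o h) by exact: continuous_integrable_itv.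
have := @Rintegral_itvB R h (BLeft a) (BRight c) b ih.
rewrite !bnd_simp => /(_ ab bc).
rewrite Rintegral_itv_obnd_cbnd.
  by move=> <-; rewrite addrC subrK.
apply: integrableS ih => //.
by apply: subset_itv; rewrite ?bnd_simp.
Qed.

(** The part of the window that leaves the period on the right is a translate
    of the part that it misses on the left. *)
Lemma Rintegral_periodic h (s : R) : continuous h -> (forall t, h (t + 1) = h t) ->
  \int[mu]_(t in `[0, 1]) h (t + s) = \int[mu]_(t in `[0, 1]) h t.
Proof.
move=> ch h1.
have hz (z : int) t : h (t + z%:~R) = h t.
  have hn (n : nat) u : h (u + n%:R) = h u.
    by elim: n => [|n IH]; rewrite ?addr0// -natr1 addrA h1.
  case: z => n; first exact: hn.
  by rewrite NegzE mulrNz -(hn n.+1 (t - _)) subrK.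
have cs (u : R) : continuous (fun t => h (t + u)).
  move=> t; apply: continuous_comp; last exact: ch.
  by apply: cvgD; [exact: cvg_id|exact: cvg_cst].
(* the integer part of the shift is absorbed by periodicity *)
pose u := s - (Num.floor s)%:~R.
have u0 : 0 <= u by rewrite subr_ge0 floor_le.
have u1 : u <= 1.
  by rewrite lerBlDl ltW// (lt_le_trans (floorD1_gt s))// intrD1.
transitivity (\int[mu]_(t in `[0, 1]) h (t + u)).
  by apply: eq_Rintegral => t _; rewrite /u addrA -mulrNz hz.
rewrite -Rintegral_shift// (Rintegral_split (b := 1)) ?add0r ?lerDl//.
rewrite (Rintegral_split (a := 0) (b := u) (c := 1))// addrC; congr (_ + _).
have := @Rintegral_shift h 0 u 1 u0 ch; rewrite add0r (addrC u) => ->.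
by apply: eq_Rintegral => t _; rewrite h1.
Qed.

End UnitInterval.

(** * Averages along a vector and polynomials *)

Section Averages.
Variables (R : realType) (V : normedModType R).
Local Notation mu := (@lebesgue_measure R).
Implicit Types (g : V -> R) (v w : V).

Definition avg w g : V -> R := fun x => \int[mu]_(t in `[0, 1]) g (x + t *: w).

Lemma continuous_line g x w : continuous g -> continuous (fun t : R => g (x + t *: w)).
Proof.
move=> cg t; apply: continuous_comp; last exact: cg.
apply: cvgD; first exact: cvg_cst.
by apply: cvgZr_tmp; exact: cvg_id.
Qed.

Lemma integrable_line g x w : continuous g ->
  mu.-integrable `[0, 1] (EFin \o (fun t : R => g (x + t *: w))).
Proof. by move=> cg; apply/continuous_integrable_itv/continuous_line. Qed.

Lemma avgB w g1 g2 : continuous g1 -> continuous g2 ->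
  avg w (g1 \- g2) = avg w g1 \- avg w g2.
Proof.
move=> c1 c2; apply/funext => x; rewrite /avg/= RintegralB//;
exact: integrable_line.
Qed.

Lemma avgD w g1 g2 : continuous g1 -> continuous g2 ->
  avg w (g1 \+ g2) = avg w g1 \+ avg w g2.
Proof.
move=> c1 c2; apply/funext => x; rewrite /avg/= RintegralD//;
exact: integrable_line.
Qed.

Lemma avg_cst w (c : R) : avg w (cst c) = cst c.
Proof.
apply/funext => x; rewrite /avg/= Rintegral_cst//=.
by rewrite lebesgue_measure_itv/= lte01 oppr0 adde0 mulr1.
Qed.

Lemma avg_continuous w g : continuous g -> continuous (avg w g).
Proof.
move=> cg x; apply/cvgrPdist_le => e e0.
(* by compactness of the segment, continuity is uniform along it *)
have : \forall y \near x, `[0, 1] `<=`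
    (fun t : R => `|g (x + t *: w) - g (y + t *: w)| <= e).
  have /compact_near_coveringP := @segment_compact R 0 1.
  apply => t t01.
  have cG : {for (t, x), continuous (fun p : R * V => g (p.2 + p.1 *: w))}.
    apply: continuous_comp; last exact: cg.
    apply: cvgD; first exact: cvg_snd.
    by apply: cvgZr_tmp; exact: cvg_fst.
  have e2 : 0 < e / 2 by rewrite divr_gt0.
  have /cvgrPdist_lt/(_ _ e2)[[U1 U2] /= [U1t U2x] UU] := cG.
  exists (U1, U2); first by [].
  (* both points are compared with the value at (t, x) *)
  move=> [s y] /= [Us Uy]; rewrite (splitr e).
  have h1 := UU (s, x) (conj Us (nbhs_singleton U2x)).
  have h2 := UU (s, y) (conj Us Uy).
  rewrite /= in h1 h2; rewrite (le_trans (ler_distD (g (x + t *: w)) _ _))//.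
  by rewrite lerD// ltW// distrC.
apply: filterS => y yP.
have iB : mu.-integrable `[0, 1]
    (EFin \o (fun t : R => g (x + t *: w) - g (y + t *: w))).
  by apply: continuous_integrable_itv => t; apply: cvgB; exact: continuous_line.
rewrite /avg -RintegralB//; [|exact: integrable_line..].
rewrite (le_trans (le_normr_Rintegral _ iB))//.
have -> : e = \int[mu]_(t in `[0, 1]) e.
  by rewrite Rintegral_cst//= lebesgue_measure_itv/= lte01 oppr0 adde0 mulr1.
apply: le_Rintegral => //.
- by have := integrable_norm iB.
- by apply: continuous_integrable_itv; exact: cst_continuous.
Qed.

Definition period g v := forall x, g (x + v) = g x.

Lemma avg_period w g v : period g v -> period (avg w g) v.
Proof. by move=> pg x; apply: eq_Rintegral => t _; rewrite addrAC pg. Qed.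

(** This is what averaging is for: the integral of a w-periodic function over a
    full period in the direction w does not depend on where the period starts. *)
Lemma avg_period_line w g (s : R) : continuous g -> period g w ->
  period (avg w g) (s *: w).
Proof.
move=> cg pg x; rewrite /avg.
have := @Rintegral_periodic R (fun t => g (x + t *: w)) s.
move=> <-; first by apply: eq_Rintegral => t _; rewrite scalerDl (addrC (t *: w)) addrA.
- exact: continuous_line.
- by move=> t; rewrite scalerDl scale1r addrA pg.
Qed.

(** Polynomials of degree less than k in the sense of Frechet. Differences,
    unlike coefficients, make sense on any normed space and commute with
    averaging. *)
Fixpoint frechet_poly k g : Prop :=
  if k is k'.+1 then forall h, frechet_poly k' (fun x => g (x + h) - g x)
  else g = cst 0.

Lemma frechet_poly0 k : frechet_poly k (cst 0).
Proof.
elim: k => //= k IH h; rewrite (_ : (fun _ => _) = cst 0)//.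
by apply/funext => x; rewrite /= subrr.
Qed.

Lemma frechet_polyS k g : frechet_poly k g -> frechet_poly k.+1 g.
Proof.
elim: k g => [|k IH] g; last by move=> pg h; apply: IH; exact: pg.
by move=> ->; exact: (frechet_poly0 1).
Qed.

Lemma frechet_poly_le k m g : (k <= m)%N -> frechet_poly k g -> frechet_poly m g.
Proof.
by move=> /subnK <-; elim: (m - k)%N => //= b IH pg; exact/frechet_polyS/IH.
Qed.

Lemma frechet_polyD k g1 g2 : frechet_poly k g1 -> frechet_poly k g2 ->
  frechet_poly k (g1 \+ g2).
Proof.
elim: k g1 g2 => [|k IH] g1 g2 /=.
  by move=> -> ->; apply/funext => x /=; rewrite addr0.
move=> p1 p2 h; have := IH _ _ (p1 h) (p2 h).
by congr frechet_poly; apply/funext => x /=; ring.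
Qed.

Lemma frechet_polyZ k c g : frechet_poly k g -> frechet_poly k (fun x => c * g x).
Proof.
elim: k g => [|k IH] g /=.
  by move=> ->; apply/funext => x /=; rewrite mulr0.
move=> p1 h; have := IH _ (p1 h).
by congr frechet_poly; apply/funext => x /=; ring.
Qed.

Lemma frechet_poly_translate k g v : frechet_poly k g ->
  frechet_poly k (fun x => g (x + v)).
Proof.
elim: k g => [|k IH] g /=.
  by move=> ->.
move=> p1 h; have := IH _ (p1 h).
by congr frechet_poly; apply/funext => x /=; rewrite addrAC.
Qed.

Lemma continuous_diff g (h : V) : continuous g -> continuous (fun x => g (x + h) - g x).
Proof.
move=> cg x; apply: cvgB; last exact: cg.
apply: continuous_comp; last exact: cg.
by apply: cvgD; [exact: cvg_id|exact: cvg_cst].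
Qed.

(** Averaging fixes constants and commutes with differences, so that the claim
    for g reduces to the claim for its differences. *)
Lemma frechet_poly_avg k w g : continuous g -> frechet_poly k.+1 g ->
  frechet_poly k (g \- avg w g).
Proof.
elim: k g => [|k IH] g cg pg.
  have gE x : g x = g 0.
    have /= /(congr1 (@^~ 0))/= := pg x.
    by rewrite add0r => /eqP; rewrite subr_eq0 => /eqP.
  rewrite /= (_ : g = cst (g 0)) ?avg_cst; first by apply/funext => x; rewrite /= subrr.
  by apply/funext => x; rewrite gE.
move=> h /=; have := IH _ (@continuous_diff g h cg) (pg h).
congr frechet_poly; apply/funext => x /=.
rewrite (_ : (fun y => g (y + h) - g y) = (fun y => g (y + h)) \- g)//.
rewrite avgB//=.
  rewrite (_ : avg w (fun y => g (y + h)) x = avg w g (x + h)); first by ring.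
  by apply: eq_Rintegral => t _; rewrite addrAC.
move=> y; apply: continuous_comp; last exact: cg.
by apply: cvgD; [exact: cvg_id|exact: cvg_cst].
Qed.

End Averages.

(** * From periods to invariant lines *)

Section Straighten.
Variables (R : realType) (V : normedModType R).
Implicit Types (g : V -> R) (v w : V).

Lemma avg_sum (I : Type) (r : seq I) (g : I -> V -> R) w x :
  (forall i, continuous (g i)) ->
  avg w (fun y => \sum_(i <- r) g i y) x = \sum_(i <- r) avg w (g i) x.
Proof.
move=> cg; elim: r => [|i r IH].
  rewrite big_nil (_ : (fun _ => _) = cst 0) ?avg_cst//.
  by apply/funext => y; rewrite big_nil.
rewrite big_cons -IH (_ : (fun _ => _) = g i \+ (fun y => \sum_(j <- r) g j y)).
  by rewrite avgD//; exact: continuous_sumf.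
by apply/funext => y; rewrite big_cons.
Qed.

(** One average straightens the direction w in all summands that have w as a
    period, at the cost of replacing P by its average. The defect P - avg w P has
    lower degree and splits into the functions g j - avg w (g j), whose periods
    include those of g j; it is decomposed by induction on the degree. *)
Lemma straighten_direction n k P (g : 'I_n -> V -> R) w :
  frechet_poly k P -> (forall j, continuous (g j)) ->
  (forall x, P x = \sum_j g j x) ->
  exists g' : 'I_n -> V -> R,
    [/\ forall j, continuous (g' j), forall x, P x = \sum_j g' j x,
        forall j v, period (g j) v -> period (g' j) v &
        forall j, period (g j) w -> forall s : R, period (g' j) (s *: w)].
Proof.
elim: k P g => [|k IH] P g.
  move=> /= -> cg _; exists (fun _ => cst 0); split => //=.
  - by move=> j; exact: cst_continuous.
  - by move=> x; rewrite big1.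
move=> pP cg Pg.
have ca j : continuous (avg w (g j)) by exact: avg_continuous.
have PE : P = fun x => \sum_j g j x by apply/funext.
have cP : continuous P by rewrite PE; exact: continuous_sumf.
have [|j|x|h [ch hE hp hw]] := IH (P \- avg w P) (fun j => g j \- avg w (g j)).
- exact: frechet_poly_avg.
- by move=> x; apply: cvgB; [exact: cg|exact: ca].
- by rewrite /= {1 2}PE avg_sum// -sumrB.
exists (fun j => avg w (g j) \+ h j); split.
- by move=> j x; apply: cvgD; [exact: ca|exact: ch].
- by move=> x; rewrite big_split/= -hE/= {2 3}PE avg_sum// addrC subrK.
- move=> j v pv x /=; rewrite avg_period// hp// => y /=.
  by rewrite avg_period// pv.
- move=> j pw s x /=; rewrite avg_period_line// hw// => y /=.
  by rewrite avg_period// pw.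
Qed.

(** Directions are treated one after the other: invariance along the lines already
    gained is a family of periods, and later steps keep all periods. *)
Lemma straighten_directions n k P (g : 'I_n -> V -> R) (W : seq V) :
  frechet_poly k P -> (forall j, continuous (g j)) ->
  (forall x, P x = \sum_j g j x) ->
  exists g' : 'I_n -> V -> R,
    [/\ forall j, continuous (g' j), forall x, P x = \sum_j g' j x &
        forall j w, w \in W -> period (g j) w -> forall s : R, period (g' j) (s *: w)].
Proof.
move=> pP cg Pg.
suff [g' [cg' Pg' _ gW]] : exists g' : 'I_n -> V -> R,
    [/\ forall j, continuous (g' j), forall x, P x = \sum_j g' j x,
        forall j v, period (g j) v -> period (g' j) v &
        forall j w, w \in W -> period (g j) w -> forall s : R, period (g' j) (s *: w)].
  by exists g'.
elim: W => [|w W [g1 [c1 P1 p1 W1]]]; first by exists g; split.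
have [g2 [c2 P2 p2 W2]] := straighten_direction w pP c1 P1.
exists g2; split => //.
- by move=> j v /p1/p2.
- move=> j u; rewrite inE => /predU1P[-> /p1/W2//|uW pu s].
  by apply: p2; exact: W1.
Qed.

End Straighten.

Section Monomials.
Variables (R : realType) (d : nat).
Implicit Types g : 'cV[R]_d -> R.

(** Leibniz rule for differences: the difference of x_i g(x) along h is
    x_i times that of g, plus h_i g(x + h). *)
Lemma frechet_poly_coord k g (i : 'I_d) : frechet_poly k g ->
  frechet_poly k.+1 (fun x : 'cV[R]_d => x i 0 * g x).
Proof.
elim: k g => [|k IH] g.
  move=> -> h; rewrite (_ : (fun _ => _) = cst 0)//.
  by apply/funext => x /=; rewrite !mulr0 subrr.
move=> pg h.
have p1 := IH _ (pg h).
have p2 := frechet_polyZ (h i 0) (frechet_poly_translate h pg).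
have := frechet_polyD p1 p2; congr frechet_poly.
by apply/funext => x /=; rewrite mxE; ring.
Qed.

Lemma frechet_poly_monom (r : seq 'I_d) (a : 'I_d -> nat) :
  exists k, frechet_poly k (fun x : 'cV[R]_d => \prod_(l <- r) x l 0 ^+ a l).
Proof.
elim: r => [|l r [k IH]].
  exists 1%N => h /=; apply/funext => x; by rewrite !big_nil subrr.
have [m] : exists m, frechet_poly m
    (fun x : 'cV[R]_d => x l 0 ^+ a l * \prod_(l <- r) x l 0 ^+ a l).
  elim: (a l) => [|b [m IHb]].
    by exists k; move: IH; congr frechet_poly; apply/funext => x; rewrite expr0 mul1r.
  exists m.+1; have := frechet_poly_coord l IHb; congr frechet_poly.
  by apply/funext => x; rewrite exprS mulrA.
by exists m; move: p; congr frechet_poly; apply/funext => x; rewrite big_cons.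
Qed.

Lemma frechet_poly_sum (I : Type) (r : seq I) (c : I -> R) (a : I -> 'I_d -> nat) :
  exists k, frechet_poly k
    (fun x : 'cV[R]_d => \sum_(i <- r) c i * \prod_l x l 0 ^+ a i l).
Proof.
elim: r => [|i r [k IH]].
  by exists 0%N; apply/funext => x; rewrite big_nil.
have [m pm] := frechet_poly_monom (index_enum 'I_d) (a i).
exists (maxn m k).
have p1 := frechet_poly_le (leq_maxl m k) (frechet_polyZ (c i) pm).
have := frechet_polyD p1 (frechet_poly_le (leq_maxr m k) IH).
by congr frechet_poly; apply/funext => x; rewrite big_cons.
Qed.

End Monomials.

(** * Extension of lattice functions *)

Section Interpolation.
Variables (R : realType) (d n : nat).
Hypothesis n_gt0 : (0 < n)%N.
Local Notation Z := 'cV[int]_d.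
Local Notation V := 'cV[R]_d.

Definition lattice_pt (b : Z) : V := map_mx intr b.

Definition lagrange_node (i : 'I_n) : {poly R} :=
  tnth (lagrange n (fun j => j%:R : R)) i.

(** Exactness of Lagrange interpolation, for the polynomial ('X + c)^a. *)
Lemma lagrange_node_pow (a : nat) (u c : R) : (a < n)%N ->
  \sum_(i < n) (c + i%:R) ^+ a * (lagrange_node i).[u] = (c + u) ^+ a.
Proof.
move=> an; pose p : {poly R} := ('X + c%:P) ^+ a.
have natI : injective (fun j => j%:R : R) by move=> i j /eqP; rewrite eqr_nat => /eqP.
have sp : (size p <= n)%N.
  rewrite (leq_trans (size_poly_exp_leq _ _))//.
  by rewrite size_XaddC mul1n.
transitivity p.[u]; last by rewrite /p !hornerE addrC.
rewrite [in RHS](lagrange_gen n_gt0 natI sp) horner_sum.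
by apply: eq_bigr => i _; rewrite /p !hornerE [c + _]addrC.
Qed.

(** The tensor product of Lagrange interpolations, with nodes b + {0, ..., n-1}^d. *)
Definition interpolant (f : Z -> R) (b : Z) (x : V) : R :=
  \sum_(i : {ffun 'I_d -> 'I_n}) f (b + \col_l (i l)%:Z) *
    \prod_l (lagrange_node (i l)).[x l 0 - (b l 0)%:~R].

Lemma interpolant_monom (a : 'I_d -> nat) b x : (forall l, (a l < n)%N) ->
  interpolant (fun z => \prod_l (z l 0)%:~R ^+ a l) b x = \prod_l x l 0 ^+ a l.
Proof.
move=> an; rewrite /interpolant.
pose F l (i : 'I_n) := 
  ((b l 0)%:~R + i%:R) ^+ a l * (lagrange_node i).[x l 0 - (b l 0)%:~R].
transitivity (\sum_(i : {ffun 'I_d -> 'I_n}) \prod_l F l (i l)).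
  apply: eq_bigr => i _; rewrite -big_split/=; apply: eq_bigr => l _.
  by rewrite !mxE intrD.
rewrite -(bigA_distr_bigA F); apply: eq_bigr => l _.
by rewrite lagrange_node_pow// addrC subrK.
Qed.

Lemma interpolant_sum (I : Type) (r : seq I) (c : I -> R) (f : I -> Z -> R) b x :
  interpolant (fun z => \sum_(i <- r) c i * f i z) b x =
  \sum_(i <- r) c i * interpolant (f i) b x.
Proof.
rewrite /interpolant; under [RHS]eq_bigr do rewrite mulr_sumr.
rewrite exchange_big/=; apply: eq_bigr => e _.
by rewrite mulr_suml; apply: eq_bigr => i _; rewrite mulrA.
Qed.

Lemma continuous_coordB (l : 'I_d) (c : R) : continuous (fun x : V => x l 0 - c).
Proof. by apply: continuous_subc; exact: coord_continuous. Qed.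

Lemma interpolant_continuous f b : continuous (interpolant f b).
Proof.
apply: continuous_sumf => i; apply: continuous_mulf; first exact: cst_continuous.
apply: continuous_prodf => l; apply: (continuous_compf (@continuous_coordB _ _)).
exact: continuous_horner.
Qed.

Lemma interpolant_shift f b c x :
  interpolant f (b + c) (x + lattice_pt c) = interpolant (fun z => f (z + c)) b x.
Proof.
apply: eq_bigr => i _; rewrite addrAC; congr (_ * _); apply: eq_bigr => l _.
by congr horner; rewrite !mxE intrD opprD addrACA subrr addr0.
Qed.

Definition tent (u : R) : R := Num.max 0 (1 - `|u|).

Definition tent_at (b : Z) (x : V) : R := \prod_l tent (x l 0 - (b l 0)%:~R).

Lemma tent_continuous : continuous tent.
Proof.
move=> u; apply: (@continuous_max R R (fun=> 0) (fun u => 1 - `|u|)).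
  exact: cvg_cst.
by apply: cvgB; [exact: cvg_cst|exact: norm_continuous].
Qed.

Lemma tent_at_continuous b : continuous (tent_at b).
Proof.
apply: continuous_prodf => l; apply: (continuous_compf (@continuous_coordB _ _)).
exact: tent_continuous.
Qed.

Lemma tent_at_neq0 b x l : tent_at b x != 0 -> `|x l 0 - (b l 0)%:~R| < 1.
Proof.
move=> /prodf_neq0/(_ l isT); rewrite /tent; apply: contra_neqT.
by rewrite -leNgt => h; apply/max_idPl; rewrite subr_le0.
Qed.

(** In each coordinate, the four integers -1, 0, 1, 2 away from the floor contain
    all integers at distance less than 2 from x, hence all that carry a tent
    which is nonzero somewhere within distance 1 of x. *)
Definition lattice_nbr (x : V) (e : {ffun 'I_d -> 'I_4}) : Z :=
  \col_l (Num.floor (x l 0) - 1 + (e l)%:Z).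

(** Local finiteness: near x, the sum over the lattice runs over a finite set
    which does not depend on the nearby point y. *)
Lemma fsum_lattice_nbr (G : Z -> R) (x y : V) :
  (forall l, `|y l 0 - x l 0| < 1) ->
  \sum_(b \in [set: Z]) tent_at b y * G b =
  \sum_e tent_at (lattice_nbr x e) y * G (lattice_nbr x e).
Proof.
move=> yx.
have inj : injective (lattice_nbr x).
  move=> e1 e2 /colP h; apply/ffunP => l; have := h l.
  by rewrite !mxE => /addrI[/ord_inj].
pose nbrs := [seq lattice_nbr x e | e <- index_enum {ffun 'I_d -> 'I_4}].
rewrite -(fsbig_widen [set` nbrs])//.
  rewrite -fsbig_seq ?big_map// map_inj_uniq//; exact: index_enum_uniq.
move=> b [_ /= nb]; apply/eqP; rewrite mulf_eq0; apply/orP; left.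
apply: contra_notT nb => tb; apply/mapP.
have bl l : exists k : 'I_4, b l 0 = Num.floor (x l 0) - 1 + k%:Z.
  have := tent_at_neq0 l tb; have := yx l.
  have := floor_le (x l 0).
  have := floorD1_gt (x l 0).
  set m := Num.floor _; move: (b l 0) => c.
  rewrite !ltr_norml intrD => h1 h2 /andP[h3 h4] /andP[h5 h6].
  have h7 : (m - 2)%:~R < c%:~R :> R by rewrite intrD; lra.
  have h8 : c%:~R < (m + 3)%:~R :> R by rewrite intrD; lra.
  rewrite !ltr_int in h7 h8.
  have hk : (absz ((c : int) - (m - 1))%R < 4)%N by lia.
  by exists (Ordinal hk) => /=; lia.
have [k bk] := choice bl.
exists [ffun l => k l]; first exact: mem_index_enum.
by apply/colP => l; rewrite mxE ffunE bk.
Qed.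

Lemma tent_sum1 (u : R) : \sum_(k < 4) tent (u - (Num.floor u - 1 + k%:Z)%:~R) = 1.
Proof.
have := floor_le u; have := floorD1_gt u.
set m := Num.floor u; rewrite intrD => h1 h2.
rewrite !big_ord_recr big_ord0/= /tent !intrD/=.
rewrite ger0_norm; last by lra.
rewrite ger0_norm; last by lra.
rewrite ler0_norm; last by lra.
rewrite ler0_norm; last by lra.
rewrite max_l; last by lra.
rewrite max_r; last by lra.
rewrite max_r; last by lra.
rewrite max_l; last by lra.
lra.
Qed.

Lemma tent_at_sum1 x : \sum_e tent_at (lattice_nbr x e) x = 1.
Proof.
pose F l (k : 'I_4) := tent (x l 0 - (Num.floor (x l 0) - 1 + k%:Z)%:~R).
transitivity (\sum_(e : {ffun 'I_d -> 'I_4}) \prod_l F l (e l)).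
  by apply: eq_bigr => e _; apply: eq_bigr => l _; rewrite !mxE.
rewrite -(bigA_distr_bigA F) big1// => l _; exact: tent_sum1.
Qed.

(** The blend of all local interpolants of a lattice function. Interpolation
    makes it exact on polynomials, the tents make it continuous, and the lack of
    a preferred lattice point makes it commute with lattice translations. *)
Definition extend (f : Z -> R) (x : V) : R :=
  \sum_(b \in [set: Z]) tent_at b x * interpolant f b x.

Lemma extend_continuous f : continuous (extend f).
Proof.
move=> x.
have near_x : \forall y \near (x : V), forall l, `|(y : V) l 0 - x l 0| < 1.
  exists (fun i j => [set z : R | `|z - x i j| < 1]); last by move=> y /= h l; exact: h.
  move=> i j /=; have : (z @[z --> x i j] --> x i j) by exact: cvg_id.
  by move/cvgrPdist_lt/(_ 1 ltr01); apply: filterS => z; rewrite distrC.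
pose local (y : V) := \sum_e
  tent_at (lattice_nbr x e) y * interpolant f (lattice_nbr x e) y.
have c : {for x, continuous local}.
  apply: continuous_sumf => e.
  apply: continuous_mulf; first exact: tent_at_continuous.
  exact: interpolant_continuous.
have eqx : \forall y \near (x : V), local y = extend f y.
  by apply: filterS near_x => y /(fsum_lattice_nbr (fun b => interpolant f b y)).
exact: continuous_near_eq eqx c.
Qed.

(** Every interpolant of a polynomial of small degree is that polynomial, and the
    tents have sum 1. *)
Lemma extend_poly (I : Type) (r : seq I) (c : I -> R) (a : I -> 'I_d -> nat) x :
  (forall i l, (a i l < n)%N) ->
  extend (fun z => \sum_(i <- r) c i * \prod_l (z l 0)%:~R ^+ a i l) x =
  \sum_(i <- r) c i * \prod_l x l 0 ^+ a i l.
Proof.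
move=> an; rewrite /extend (@fsum_lattice_nbr _ x x); last first.
  by move=> l; rewrite subrr normr0.
rewrite -[RHS]mul1r -[X in X * _](tent_at_sum1 x) mulr_suml; apply: eq_bigr => e _.
rewrite interpolant_sum; congr (_ * _).
by apply: eq_bigr => i _; rewrite interpolant_monom.
Qed.

Lemma extend_sum m (f : 'I_m -> Z -> R) x :
  extend (fun z => \sum_j f j z) x = \sum_j extend (f j) x.
Proof.
have xx l : `|x l 0 - x l 0| < 1 by rewrite subrr normr0.
rewrite /extend (fsum_lattice_nbr _ xx).
under [RHS]eq_bigr do rewrite (fsum_lattice_nbr _ xx).
rewrite exchange_big/=; apply: eq_bigr => e _; rewrite -mulr_sumr; congr (_ * _).
have := @interpolant_sum _ (index_enum 'I_m) (fun=> 1) f (lattice_nbr x e) x.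
under [in RHS]eq_bigr do rewrite mul1r.
move=> <-; congr interpolant; apply/funext => z.
by apply: eq_bigr => j _; rewrite mul1r.
Qed.

Lemma extend_period f c : (forall z, f (z + c) = f z) ->
  period (extend f) (lattice_pt c).
Proof.
move=> fc x; rewrite /extend (reindex_fsbigT (fun b => b + c))/=; last first.
  by exists (fun b => b - c) => b; rewrite ?addrK ?subrK.
apply: eq_fsbigr => b _; rewrite interpolant_shift; congr (_ * _).
  by apply: eq_bigr => l _; congr tent; rewrite !mxE intrD opprD addrACA subrr addr0.
by congr interpolant; apply/funext => z.
Qed.

End Interpolation.

(** * Countable linear systems *)

Section CountableSystem.
Variables (K : fieldType) (X : eqType) (n : nat) (u : X -> 'I_n -> nat) (c : X -> K).
Implicit Types (S : seq X) (v g : nat -> K).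

Definition solves S g := forall x, x \in S -> \sum_j g (u x j) = c x.

(** Consistency of a partial assignment: the values of v at the first r unknowns
    can be completed to a solution of any given finite subsystem. *)
Definition extendable r v := forall S,
  exists g, solves S g /\ forall y, (y < r)%N -> g y = v y.

Definition update v r (a : K) : nat -> K := fun y => if y == r then a else v y.

(** The values that solutions of S can take at a new variable form an affine
    subspace of the line: either one finite subsystem forces the value, or
    every value can be chosen. *)
Lemma extendableS r v : extendable r v -> exists a, extendable r.+1 (update v r a).
Proof.
move=> ev.
pose ok S a := exists g, [/\ solves S g, forall y, (y < r)%N -> g y = v y & g r = a].
have okP a : (forall S, ok S a) -> extendable r.+1 (update v r a).
  move=> oka S; have [g [sg gv ga]] := oka S; exists g; split => // y.
  rewrite ltnS leq_eqVlt /update => /predU1P[->|yr]; first by rewrite eqxx.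
  by rewrite ltn_eqF// gv.
have [[S [a [_ rigid]]]|free] :=
    pselect (exists S a, ok S a /\ forall b, ok S b -> b = a).
  exists a; apply: okP => S'; have [g [sg gv]] := ev (S ++ S').
  exists g; split => //.
    by move=> x xS; apply: sg; rewrite mem_cat xS orbT.
  apply: rigid; exists g; split => // x xS.
  by apply: sg; rewrite mem_cat xS.
exists 0; apply: okP => S; have [g [sg gv]] := ev S.
(* two solutions of S with different values at r give all values at r *)
have [b [[g' [sg' gv' gb]] ba]] : exists b, ok S b /\ b != g r.
  apply: contrapT => nb; apply: free; exists S, (g r); split; first by exists g.
  by move=> b okb; apply: contrapT => /eqP bg; apply: nb; exists b.
have bg0 : b - g r != 0 by rewrite subr_eq0.
pose t := b / (b - g r).
exists (fun y => t * g y + (1 - t) * g' y); split.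
- move=> x xS; rewrite big_split/= -!mulr_sumr sg// sg'//; ring.
- by move=> y yr; rewrite gv// gv'//; ring.
- by rewrite gb /t; field.
Qed.

(** Compactness: the unknowns are fixed one by one, keeping all finite subsystems
    solvable. An equation involves finitely many unknowns, so it holds as soon as
    these have been fixed. *)
Lemma countable_system_solvable :
  (forall S, exists g, solves S g) -> exists v, forall x, \sum_j v (u x j) = c x.
Proof.
move=> fin.
have /choice[a aP] (p : nat * (nat -> K)) : exists b,
    extendable p.1 p.2 -> extendable p.1.+1 (update p.2 p.1 b).
  have [/extendableS[b hb]|h] := pselect (extendable p.1 p.2); first by exists b.
  by exists 0.
pose w := fix w r := if r is r'.+1 then update (w r') r' (a (r', w r')) else (fun=> 0).
have wP r : extendable r (w r).
  elim: r => [|r IH]; last exact: (aP (r, w r)).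
  by move=> S; have [g sg] := fin S; exists g; split.
have wE y r : (y < r)%N -> w r y = w y.+1 y.
  elim: r => // r IH; rewrite ltnS leq_eqVlt => /predU1P[->//|yr].
  by rewrite -(IH yr)/= /update ltn_eqF.
(* the unknown y keeps the value that it receives at step y.+1 *)
exists (fun y => w y.+1 y) => x.
pose r := (\max_j u x j).+1.
have [g [sg gw]] := wP r [:: x].
rewrite -(sg x (mem_head _ _)); apply: eq_bigr => j _.
have ur : (u x j < r)%N by rewrite ltnS; exact: leq_bigmax.
by rewrite gw// wE.
Qed.

End CountableSystem.

(** * Integer matrices *)

Section IntegerKernel.
Variables (R : realType) (m d : nat) (M : 'M[int]_(m, d)).

(** The kernel of a rational matrix has a rational spanning family, which still
    spans after extension of scalars to R and whose denominators can be
    cleared. *)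
Lemma int_kernel_span : exists w : 'I_d -> 'cV[int]_d,
  (forall i, M *m w i = 0) /\
  forall v : 'cV[R]_d, map_mx intr M *m v = 0 ->
    exists s : 'I_d -> R, v = \sum_i s i *: lattice_pt R (w i).
Proof.
pose Q : 'M[rat]_(m, d) := map_mx intr M.
pose K := kermx Q^T.
pose D : int := \prod_(p : 'I_d * 'I_d) denq (K p.1 p.2).
have D0 : D != 0 by apply/prodf_neq0 => p _; rewrite denq_neq0.
pose w (i : 'I_d) : 'cV[int]_d := \col_j numq (D%:~R * K i j).
have wE i j : (w i j 0)%:~R = D%:~R * K i j :> rat.
  rewrite mxE numqK// /D (bigD1 (i, j))//= intrM mulrAC [_ * K i j]mulrC -numqE.
  by rewrite rpredM// intr_int.
exists w; split.
  move=> i; apply/colP => k; rewrite !mxE.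
  have /matrixP/(_ i k) : K *m Q^T = 0 by exact: mulmx_ker.
  rewrite !mxE => h; apply: (@intr_inj rat); rewrite rmorph_sum/= rmorph0.
  transitivity (D%:~R * \sum_j K i j * Q^T j k); last by rewrite h mulr0.
  rewrite mulr_sumr; apply: eq_bigr => j _.
  by rewrite rmorphM/= wE !mxE; ring.
move=> v Mv.
have : (v^T <= map_mx ratr K)%MS.
  rewrite map_kermx; apply/sub_kermxP.
  have -> : map_mx ratr Q^T = (map_mx intr M)^T :> 'M[R]_(d, m).
    by apply/matrixP => i j; rewrite !mxE ratr_int.
  by rewrite -trmx_mul Mv trmx0.
move=> /submxP[s sE].
exists (fun i => s 0 i / D%:~R); apply/colP => j.
have := congr1 (fun A : 'rV_d => A 0 j) sE; rewrite !mxE summxE => ->.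
apply: eq_bigr => i _; rewrite [in RHS]mxE.
have -> : lattice_pt R (w i) j 0 = D%:~R * ratr (K i j).
  have := congr1 (ratr : rat -> R) (wE i j).
  by rewrite rmorphM/= !ratr_int => <-; rewrite mxE.
by rewrite mxE; field; rewrite intr_eq0.
Qed.

End IntegerKernel.

(** * Continuous decompositions of polynomials *)

Section RealDecomposition.
Variables (R : realType) (d n N : nat) (dd : 'I_n -> nat).
Variable M : forall j : 'I_n, 'M[int]_(dd j, d).
Variables (c : 'I_N -> R) (a : 'I_N -> 'I_d -> nat).

Definition monomial_sum (x : 'cV[R]_d) : R := \sum_k c k * \prod_l x l 0 ^+ a k l.

(** The heart of the proof: [extend] makes the summands continuous, and
    [straighten_directions] turns their integer periods into real ones. *)
Lemma lattice_decomposition_continuous (F : 'I_n -> 'cV[int]_d -> R) :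
  (forall z, monomial_sum (lattice_pt R z) = \sum_j F j z) ->
  (forall j z b, M j *m b = 0 -> F j (z + b) = F j z) ->
  exists G : 'I_n -> 'cV[R]_d -> R,
    [/\ forall j, continuous (G j), forall x, monomial_sum x = \sum_j G j x &
        forall j v, map_mx intr (M j) *m v = 0 -> period (G j) v].
Proof.
move=> FE Fper.
(* nodes per coordinate: exactness needs more of them than any exponent *)
pose K := (\max_(p : 'I_N * 'I_d) a p.1 p.2).+1.
have aK k l : (a k l < K)%N by rewrite ltnS (leq_bigmax (k, l)).
have K0 : (0 < K)%N by [].
pose g j := extend K (F j).
have gE x : monomial_sum x = \sum_j g j x.
  rewrite -extend_sum// /monomial_sum -(@extend_poly R d K K0 _ _ c a x aK).
  congr extend; apply/funext => z; rewrite -FE; apply: eq_bigr => k _.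
  by congr (_ * _); apply: eq_bigr => l _; rewrite mxE.
have cg j : continuous (g j) by exact: extend_continuous.
have [k pk] := frechet_poly_sum (index_enum 'I_N) c a.
have /all_sig[w wP] j := cid (int_kernel_span R (M j)).
pose W := [seq lattice_pt R (w p.1 p.2) | p <- index_enum ('I_n * 'I_d)%type].
have [G [cG GE GW]] := straighten_directions W pk cg gE.
exists G; split => // j v Mv.
have [Mw /(_ v Mv)[s ->]] := wP j.
have pD u1 u2 : period (G j) u1 -> period (G j) u2 -> period (G j) (u1 + u2).
  by move=> p1 p2 x; rewrite addrA p2 p1.
apply: (big_ind (period (G j))); [by move=> x; rewrite addr0|exact: pD|].
move=> i _; apply: GW; first by apply/mapP; exists (j, i); rewrite ?mem_index_enum.
by apply: extend_period => z; exact: Fper.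
Qed.

End RealDecomposition.

(** * Lebesgue measurability of continuous functions *)

Section ContinuousMeasurable.
Variables (R : realType) (m : nat).
Hypothesis m_gt0 : (0 < m)%N.

(** In dimension 0 the only box has volume 1, whence the hypothesis on m. *)
Lemma lebesgue_outer0 : lebesgue_outer (set0 : set 'cV[R]_m) = 0%E.
Proof.
have v0 : box_volume (0 : 'cV[R]_m) 0 = 0.
  by case: m m_gt0 => // m' _; rewrite /box_volume big_ord_recl subrr mul0r.
apply/eqP; rewrite eq_le; apply/andP; split.
  apply: ereal_inf_lbound; exists (fun=> 0), (fun=> 0); split => //.
  by rewrite v0 eseries0.
apply: le_ereal_inf_tmp => _ [a [b [ab _ ->]]].
apply: nneseries_ge0 => k _ _; rewrite lee_fin.
by apply: prodr_ge0 => i _; rewrite subr_ge0.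
Qed.

Lemma open_lebesgue_sets (U : set 'cV[R]_m) : open U -> @lebesgue_sets R m U.
Proof.
move=> oU; exists U; first exact: sub_gen_smallest.
exists set0; last by rewrite setU0.
by exists set0; split => //; exact: lebesgue_outer0.
Qed.

Lemma continuous_lebesgue_measurable (f : 'cV[R]_m -> R) : continuous f ->
  measurable_fun [set: lebesgueType R m] (f : lebesgueType R m -> measurableTypeR R).
Proof.
move=> /continuousP cf; apply: (measurability _ (RGenOpens.measurableE R)).
move=> _ [_ [a [b ->] <-]]; rewrite setTI; apply: sub_gen_smallest.
by apply: open_lebesgue_sets; apply: cf; exact: interval_open.
Qed.

End ContinuousMeasurable.

(** * Linear maps and polynomial functions *)

Section LinearMaps.
Variable R : realType.

Lemma mulmx_continuous m k (A : 'M[R]_(k, m)) :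
  continuous (fun y : 'cV[R]_m => A *m y).
Proof.
apply: continuous_colP => i.
rewrite (_ : (fun _ => _) = fun y : 'cV[R]_m => \sum_j A i j * y j 0); last first.
  by apply/funext => y; rewrite mxE.
apply: continuous_sumf => j; apply: continuous_mulf; first exact: cst_continuous.
exact: coord_continuous.
Qed.

Lemma surjective_section d m (f : {linear 'cV[R]_d -> 'cV[R]_m}) :
  (forall y, exists x, f x = y) -> exists S : 'M[R]_(d, m), forall y, f (S *m y) = y.
Proof.
move=> /choice[s sK].
exists (\matrix_(i, j) s (delta_mx j 0) i 0) => y.
have -> : (\matrix_(i, j) s (delta_mx j 0) i 0) *m y = \sum_j y j 0 *: s (delta_mx j 0).
  apply/colP => i; rewrite !mxE summxE; apply: eq_bigr => j _.
  by rewrite !mxE mulrC.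
rewrite linear_sum/= [RHS]matrix_sum_delta; apply: eq_bigr => j _.
by rewrite linearZ/= sK big_ord1.
Qed.

End LinearMaps.

Section PolynomialFunctions.
Import -(notations) mpoly.
Variables (R : realType) (d : nat).

(** After a real linear change of variables the complex coefficients are still
    separated from the real monomials, so that real and imaginary parts can be
    treated independently. *)
Lemma poly_fun_monomials (P : mpoly.mpoly d R[i]) (A : 'M[R]_d) :
  exists N (c : 'I_N -> R[i]) (a : 'I_N -> 'I_d -> nat), forall x,
    poly_fun P (A *m x) = \sum_k c k * (\prod_l x l 0 ^+ a k l)%:C%C.
Proof.
pose lq : d.-tuple (mpoly.mpoly d R[i]) :=
  [tuple \sum_j (A i j)%:C%C *: mpoly.mpolyX _ (mpoly.mnm1 j) | i < d].
pose Q := mpoly.comp_mpoly lq P.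
pose s := mpoly.msupp Q.
exists (size s), (fun k => mpoly.mcoeff (tnth (in_tuple s) k) Q),
  (fun k l => tnth (in_tuple s) k l) => x.
transitivity (mpoly.meval (fun i => (x i 0)%:C%C) Q).
  rewrite /Q mpoly.comp_mpoly_meval; apply: mpoly.meval_eq => i.
  rewrite tnth_mktuple raddf_sum/= mxE rmorph_sum; apply: eq_bigr => j _.
  by rewrite mpoly.mevalZ mpoly.mevalXU rmorphM.
rewrite mpoly.mevalE (big_tnth _ _ s); apply: eq_bigr => k _.
by congr (_ * _); rewrite rmorph_prod; apply: eq_bigr => l _; rewrite rmorphXn.
Qed.

End PolynomialFunctions.

(** * Finite witnesses *)

Section FiniteWitness.
Variables (R : realType) (d n : nat) (dd : 'I_n -> nat).
Variable ell : forall j : 'I_n, {linear 'cV[R]_d -> 'cV[R]_(dd j)}.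

(** The span of the compositions with the ell j collapses to one composition for
    each j. *)
Lemma no_finite_witness_sum (g : 'cV[R]_d -> R[i]) :
  ~ nondegenerate_finite_witness ell g -> forall S : set 'cV[R]_d, finite_set S ->
  exists f : forall j, 'cV[R]_(dd j) -> R[i],
    forall s, S s -> g s = \sum_j f j (ell j s).
Proof.
move=> nw S fS.
have [N [c [h [hF gE]]]] : in_span_on S
    [set g | exists (j : 'I_n) (f : 'cV[R]_(dd j) -> R[i]), g = f \o ell j] g.
  by apply: contrapT => ns; apply: nw; exists S.
have /choice[f fE] k : exists f : forall j, 'cV[R]_(dd j) -> R[i],
    forall s, h k s = \sum_j f j (ell j s).
  have [j0 [f hf]] := hF k.
  (* f at the index j0 and 0 at the others, chosen pointwise to avoid a cast *)
  have /choice[f' f'E] (p : {j : 'I_n & 'cV[R]_(dd j)}) : exists z : R[i],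
      forall s, ell (tag p) s = tagged p -> z = if tag p == j0 then h k s else 0.
    case: p => j y /=; have [jj|] := eqVneq j j0; last by exists 0.
    by move: y; rewrite jj => y; exists (f y) => s <-; rewrite hf.
  exists (fun j y => f' (Tagged _ y)) => s.
  rewrite (bigD1 j0)//= (f'E _ s)//= eqxx big1 ?addr0// => j jj.
  by rewrite (f'E _ s)//= (negPf jj).
exists (fun j y => \sum_k c k * f k j y) => s Ss.
rewrite gE// exchange_big/=; apply: eq_bigr => k _.
by rewrite fE mulr_sumr.
Qed.

End FiniteWitness.

Theorem theorem2p2 (R : realType) (d n : nat) (dd : 'I_n -> nat)
  (d_gt0 : (0 < d)%N) (n_gt0 : (0 < n)%N) (dd_gt0 : forall j, (0 < dd j)%N)
  (P : mpoly.mpoly d (complex R))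
  (ell : forall j : 'I_n, {linear 'cV[R]_d -> 'cV[R]_(dd j)})
  (ell_surj : forall (j : 'I_n) (y : 'cV[R]_(dd j)), exists x, ell j x = y) :
  rationally_commensurate ell ->
  nondegenerate_rel ell (poly_fun P) ->
  nondegenerate_finite_witness ell (poly_fun P).
Proof.
move=> [A [B [Au Bu ellM]]] ndeg; apply: contrapT => nw; apply: ndeg.
have /all_sig[M ME] j := cid (ellM j).
have ellE j x : ell j (A *m x) = B j *m (map_mx intr (M j) *m x).
  by rewrite -ME mulKVmx.
have [N [c [a PE]]] := poly_fun_monomials P A.
(* the unknowns are the values at M j z, encoded together with j as numbers *)
pose u (z : 'cV[int]_d) (j : 'I_n) : nat := pickle (j, pickle (M j *m z)).
have [v vE] : exists v : nat -> R[i], forall z,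
    \sum_j v (u z j) = poly_fun P (A *m lattice_pt R z).
  apply: countable_system_solvable => S.
  pose S' := [set A *m lattice_pt R z | z in [set` S]].
  have [|f fE] := no_finite_witness_sum nw (S := S').
    exact/finite_image/finite_seq.
  pose g (k : nat) : R[i] := if unpickle k is Some (j, p) then
    oapp (fun y : 'cV[int]_(dd j) => f j (B j *m map_mx intr y)) 0 (unpickle p)
    else 0.
  exists g => z zS; rewrite fE; last by exists z.
  by apply: eq_bigr => j _; rewrite /g /u pickleK /= pickleK /= ellE map_mxM.
have uper j z b : M j *m b = 0 -> u (z + b) j = u z j.
  by move=> Mb; rewrite /u mulmxDr Mb addr0.
pose re (z : R[i]) := complex.Re z; pose im (z : R[i]) := complex.Im z.
have PRe x : re (poly_fun P (A *m x)) = monomial_sum (re \o c) a x.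
  rewrite PE /re raddf_sum; apply: eq_bigr => k _ /=.
  by case: (c k) => r1 r2; rewrite /= mulr0 subr0.
have PIm x : im (poly_fun P (A *m x)) = monomial_sum (im \o c) a x.
  rewrite PE /im raddf_sum; apply: eq_bigr => k _ /=.
  by case: (c k) => r1 r2; rewrite /= mulr0 add0r.
have decomposition := @lattice_decomposition_continuous R d n N dd M.
have [|j z b Mb|Gr [cGr GrE Grp]] :=
  decomposition (re \o c) a (fun j z => re (v (u z j))).
- by move=> z; rewrite -PRe -vE /re raddf_sum.
- by rewrite uper.
have [|j z b Mb|Gi [cGi GiE Gip]] :=
  decomposition (im \o c) a (fun j z => im (v (u z j))).
- by move=> z; rewrite -PIm -vE /im raddf_sum.
- by rewrite uper.
have /all_sig[S SE] j := cid (surjective_section (ell_surj j)).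
(* T j sends ell j x back to the coordinates of x, up to ker (M j) *)
pose T j := invmx A *m S j.
exists (fun j y => (Gr j (T j *m y) +i* Gi j (T j *m y))%C); split.
  move=> j; split => /=; apply: continuous_lebesgue_measurable => // y;
    (apply: continuous_comp; first exact: mulmx_continuous);
    [exact: cGr|exact: cGi].
move=> x; pose x' := invmx A *m x.
have xE : x = A *m x' by rewrite mulKVmx.
have kerT j : map_mx intr (M j) *m (T j *m ell j x - x') = 0.
  rewrite -[LHS](mulKmx (Bu j)) -ellE mulmxBr /T -mulmxA mulKVmx// -xE.
  by rewrite linearB/= SE subrr mulmx0.
have perT (G : 'I_n -> 'cV[R]_d -> R) j :
    (forall j v, map_mx intr (M j) *m v = 0 -> period (G j) v) ->
    G j (T j *m ell j x) = G j x'.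
  by move=> Gp; rewrite -(Gp _ _ (kerT j) x') addrC subrK.
apply/eqP; rewrite eq_complex; apply/andP; split; apply/eqP.
  rewrite {1}xE -/(re _) PRe GrE raddf_sum; apply: eq_bigr => j _.
  by rewrite /= perT.
rewrite {1}xE -/(im _) PIm GiE raddf_sum; apply: eq_bigr => j _.
by rewrite /= perT.
Qed.
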